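(* Let $m,n\geq 13$ be integers, and let $m_{13},n_{13}\in\{0,1,\dots,12\}$ be the least residues of $m$ and $n$ modulo $13$, respectively. Then $$\gamma_{b,2}(P_m\square P_n)\leq 2\left(\frac{mn}{13}\right)+4\left(\frac{m+n}{13}\right)+\frac{c(m_{13},n_{13})}{13},$$ where $c(r,s)$, for $0\le r,s\le 12$, is the entry in row $r$ and column $s$ (rows and columns indexed from $0$ to $12$) of the matrix $$\begin{pmatrix} 0&9&5&1&10&6&2&11&7&16&12&8&4\\ 9&16&10&4&11&5&12&6&0&7&1&8&2\\ 5&10&2&-6&-1&-9&-4&-12&6&11&3&8&0\\ 1&4&-6&10&0&3&6&-4&12&2&5&8&-2\\ 10&11&-1&0&-12&2&3&-9&5&6&-6&8&-4\\ 6&5&-9&3&2&-12&0&-1&11&10&-4&8&-6\\ 2&12&-4&6&3&0&10&-6&4&1&-2&8&5\\ 11&6&-12&-4&-9&-1&-6&2&10&5&0&8&3\\ 7&0&6&12&5&11&4&10&16&9&2&8&1\\ 16&7&11&2&6&10&1&5&9&0&4&8&12\\ 12&1&3&5&-6&-4&-2&0&2&4&6&8&10\\ 8&8&8&8&8&8&8&8&8&8&8&8&8\\ 4&2&0&-2&-4&-6&5&3&1&12&10&8&6 \end{pmatrix}.$$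
   Context: $P_n$ denotes the path on $n$ vertices and $\square$ the Cartesian product of graphs. For a graph $G$ of radius at least $2$, a $2$-limited broadcast is a function $f:V(G)\to\{0,1,2\}$. A vertex $u$ hears the broadcast from a vertex $v$ with $f(v)\ge 1$ if $d(u,v)\leq f(v)$, where $d$ is graph distance. The broadcast $f$ is dominating if every vertex of $G$ hears the broadcast from some vertex $v$ with $f(v)\geq 1$. The cost of $f$ is $\sum_{v\in V(G)}f(v)$. The $2$-limited broadcast domination number $\gamma_{b,2}(G)$ is the minimum cost of a $2$-limited dominating broadcast on $G$. *)

(* Defs.v *)
From HB Require Import structures.
From mathcomp Require Import all_boot all_order all_algebra.
Set Implicit Arguments.
Unset Strict Implicit.
Unset Printing Implicit Defensive.

(* A finite simple graph is a symmetric irreflexive relation on a finType. *)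

Definition path_graph (n : nat) : rel 'I_n :=
  fun i j => (i.+1 == j :> nat) || (j.+1 == i :> nat).

Definition cart_prod (T1 T2 : finType) (e1 : rel T1) (e2 : rel T2) :
    rel (T1 * T2) :=
  fun x y => ((x.1 == y.1) && e2 x.2 y.2) || ((x.2 == y.2) && e1 x.1 y.1).

Definition grid (m n : nat) : rel ('I_m * 'I_n) :=
  cart_prod (@path_graph m) (@path_graph n).

Lemma path_graph_sym n : symmetric (@path_graph n).
Proof. by move=> i j; rewrite /path_graph orbC. Qed.

Lemma path_graph_irr n : irreflexive (@path_graph n).
Proof. by move=> i; rewrite /path_graph orbb gtn_eqF. Qed.

Lemma cart_prod_sym (T1 T2 : finType) (e1 : rel T1) (e2 : rel T2) :
  symmetric e1 -> symmetric e2 -> symmetric (cart_prod e1 e2).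
Proof.
move=> s1 s2 x y; rewrite /cart_prod s1 s2.
by rewrite (eq_sym x.1) (eq_sym x.2).
Qed.

Lemma cart_prod_irr (T1 T2 : finType) (e1 : rel T1) (e2 : rel T2) :
  irreflexive e1 -> irreflexive e2 -> irreflexive (cart_prod e1 e2).
Proof. by move=> i1 i2 x; rewrite /cart_prod i1 i2 !andbF. Qed.

Section Broadcast.
Variables (T : finType) (e : rel T).

Definition walk_of_length (u v : T) (k : nat) : bool :=
  [exists p : k.-tuple T, path e u p && (last u p == v)].

(* A shortest walk has fewer than #|T| edges, so this is the graph distance
   when u and v are connected; the value is #|T| when they are not. *)
Definition gdist (u v : T) : nat := find (walk_of_length u v) (iota 0 #|T|).

Definition broadcast2 := {ffun T -> 'I_3}.

(* The connectivity test gives distance infinity to disconnected pairs. *)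
Definition hears (f : broadcast2) (u v : T) : bool :=
  [&& 1 <= f v, connect e u v & gdist u v <= f v].

Definition dominating (f : broadcast2) : bool :=
  [forall u, exists v, hears f u v].

Definition cost (f : broadcast2) : nat := \sum_v f v.

Definition ones : broadcast2 := [ffun=> inord 1].

(* The broadcast constantly 1 is always dominating (ones_dominating), so the
   default of the arg min is legitimate. *)
Definition gamma_b2 : nat := cost [arg min_(f < ones | dominating f) cost f].

Lemma gdistP u v : connect e u v ->
  walk_of_length u v (gdist u v) /\
  forall k, walk_of_length u v k -> gdist u v <= k.
Proof.
move=> /connectP[p0 ep0 ->{v}].
have [p ep Up _] := shortenP ep0; set v := last u p; rewrite /gdist.
have szp : size p < #|T| by rewrite -[_.+1]/(size (u :: p)) -(card_uniqP Up) max_card.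
have wp : walk_of_length u v (size p).
  by apply/existsP; exists (in_tuple p); rewrite /= ep eqxx.
have hasw : has (walk_of_length u v) (iota 0 #|T|).
  by apply/hasP; exists (size p) => //; rewrite mem_iota.
have ltf := hasw; rewrite has_find size_iota in ltf.
split=> [|k wk]; first by have := nth_find 0 hasw; rewrite nth_iota.
rewrite leqNgt; apply/negP => ltk.
have := before_find 0 ltk; rewrite nth_iota ?add0n ?wk //.
exact: ltn_trans ltk ltf.
Qed.

Lemma ones_dominating : dominating ones.
Proof.
apply/forallP => u; apply/existsP; exists u.
rewrite /hears ffunE inordK // connect0 /=.
have [_ /(_ 0) le0] := gdistP (connect0 e u).
by apply: leq_trans (le0 _) _ => //; apply/existsP; exists [tuple]; rewrite /= eqxx.
Qed.

Lemma gamma_b2P :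
  (exists2 f, dominating f & cost f = gamma_b2) /\
  forall f, dominating f -> gamma_b2 <= cost f.
Proof.
rewrite /gamma_b2; case: arg_minnP => [|f df fmin]; first exact: ones_dominating.
by split; first exists f.
Qed.

End Broadcast.

Definition c_rows : seq (seq int) := (
  [:: [:: 0; 9; 5; 1; 10; 6; 2; 11; 7; 16; 12; 8; 4];
      [:: 9; 16; 10; 4; 11; 5; 12; 6; 0; 7; 1; 8; 2];
      [:: 5; 10; 2; -6; -1; -9; -4; -12; 6; 11; 3; 8; 0];
      [:: 1; 4; -6; 10; 0; 3; 6; -4; 12; 2; 5; 8; -2];
      [:: 10; 11; -1; 0; -12; 2; 3; -9; 5; 6; -6; 8; -4];
      [:: 6; 5; -9; 3; 2; -12; 0; -1; 11; 10; -4; 8; -6];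
      [:: 2; 12; -4; 6; 3; 0; 10; -6; 4; 1; -2; 8; 5];
      [:: 11; 6; -12; -4; -9; -1; -6; 2; 10; 5; 0; 8; 3];
      [:: 7; 0; 6; 12; 5; 11; 4; 10; 16; 9; 2; 8; 1];
      [:: 16; 7; 11; 2; 6; 10; 1; 5; 9; 0; 4; 8; 12];
      [:: 12; 1; 3; 5; -6; -4; -2; 0; 2; 4; 6; 8; 10];
      [:: 8; 8; 8; 8; 8; 8; 8; 8; 8; 8; 8; 8; 8];
      [:: 4; 2; 0; -2; -4; -6; 5; 3; 1; 12; 10; 8; 6]])%Z.

Definition c (r s : nat) : int := nth 0%R (nth [::] c_rows r) s.

(* Main.v *)
Require Import Defs.
From HB Require Import structures.
From mathcomp Require Import all_boot all_order all_algebra.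
From mathcomp Require Import zify lra.
Set Implicit Arguments.
Unset Strict Implicit.
Unset Printing Implicit Defensive.
Import Order.TTheory GRing.Theory Num.Theory.
Local Open Scope nat_scope.

(** The balls of radius 2 in the square lattice have 13 points, and the points
    with X + 5 Y = -k modulo 13 form a perfect code: every lattice point is
    within distance 2 of exactly one code point, because the 13 displacements
    (i, j) with |i| + |j| <= 2 give the 13 residues of i + 5 j modulo 13
    [code_perfect]. Strength 2 at every code point therefore dominates the
    whole lattice at density 2/13.

    On the grid, a vertex whose code point lies outside the grid needs a
    substitute. Move that code point to the nearest vertex of the grid: if it
    was at distance o >= 1 from the grid, then it comes o closer to every vertex
    of the grid, so the vertices it served are now within distance 2 - o <= 1,
    and strength 1 suffices there [clamp_dist, gamma_le_weight]. So the cost is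
    at most twice the number of code points in the grid plus the number of code
    points outside it but within distance 2. These last lie in strips of width 2
    along the four sides, plus one diagonal cell at each corner.

    Counting is additive: every code point in the grid lies both in one of its
    rows and in one of its columns, and every code point in a side strip lies in
    exactly one of the two. Hence this bound on the cost is the number of code
    points in an m x (n + 4) rectangle, plus that in an (m + 4) x n rectangle,
    plus that among the four corner cells [sum_weight_le]. Any 13 consecutive
    cells of a row or a column contain exactly one code point, so increasing m
    by 13 increases the bound by exactly (n + 4) + n, and likewise for n; the
    same increase appears in (2 m n + 4 (m + n)) / 13, so the difference of the
    two depends only on the residues of m and n and on the offset k
    [total_shift]. What remains is finite: for each of the 169 pairs of residues
    some offset k meets the entry of the table [good_offset_ex]. *)

(** * Distances and hearing in the grid *)

Definition absdiff (a b : nat) : nat := (a - b) + (b - a).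

(** The grid distance is at most the l1 distance: any disagreeing coordinate can
    be moved one step closer without leaving the grid. *)
Lemma grid_walk m n (u v : 'I_m * 'I_n) :
  exists p, [/\ path (@grid m n) u p, last u p = v &
                size p = absdiff u.1 v.1 + absdiff u.2 v.2].
Proof.
have [d] := ubnP (absdiff u.1 v.1 + absdiff u.2 v.2).
elim: d => // d IHd in u *.
case: u v IHd => [x y] [x' y'] IHd; rewrite ltnS /= => le_d.
have step (z : 'I_m * 'I_n) :
    grid (x, y) z ->
    (absdiff z.1 x' + absdiff z.2 y').+1 = absdiff x x' + absdiff y y' ->
  exists p, [/\ path (@grid m n) (x, y) p, last (x, y) p = (x', y') &
                size p = absdiff x x' + absdiff y y'].
  move=> xyz dz; have [|p [zp pv sp]] := IHd z; first by rewrite /= dz.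
  by exists (z :: p); split=> //=; [rewrite xyz | rewrite sp].
have := ltn_ord x; have := ltn_ord x'; have := ltn_ord y; have := ltn_ord y'.
rewrite /absdiff /= in le_d step *.
have [lt_x|lt_x|/val_inj eq_x] := ltngtP x x' => lt1 lt2 lt3 lt4.
- have hx : x.+1 < m by lia.
  apply: (step (Ordinal hx, y)); last by rewrite /=; lia.
  by rewrite /grid /cart_prod /path_graph /= !eqxx orbT.
- have hx : x.-1 < m by lia.
  apply: (step (Ordinal hx, y)); last by rewrite /=; lia.
  by rewrite /grid /cart_prod /path_graph /= prednK ?eqxx ?orbT; lia.
have [lt_y|lt_y|/val_inj eq_y] := ltngtP y y'.
- have hy : y.+1 < n by lia.
  apply: (step (x, Ordinal hy)); last by rewrite /=; lia.
  by rewrite /grid /cart_prod /path_graph /= !eqxx.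
- have hy : y.-1 < n by lia.
  apply: (step (x, Ordinal hy)); last by rewrite /=; lia.
  by rewrite /grid /cart_prod /path_graph /= prednK ?eqxx ?orbT; lia.
by exists [::]; split; rewrite ?eq_x ?eq_y //= !subnn.
Qed.

Lemma grid_hears m n (f : broadcast2 _) (u v : 'I_m * 'I_n) :
  0 < f v -> absdiff u.1 v.1 + absdiff u.2 v.2 <= f v -> hears (@grid m n) f u v.
Proof.
move=> f_gt0 le_f; have [p [up pv sp]] := grid_walk u v.
have uv : connect (@grid m n) u v by apply/connectP; exists p.
rewrite /hears f_gt0 uv /=; have [_ /(_ (size p)) gle] := gdistP uv.
apply: leq_trans (gle _) _; last by rewrite sp.
by apply/existsP; exists (in_tuple p); rewrite /= up pv eqxx.
Qed.

(** Several sources may be sent to the same vertex; giving it the largest of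
    their strengths costs no more than their sum. *)
Lemma pushforward_broadcast (T S : finType) (p : S -> T) (w : S -> nat) :
  (forall s, w s <= 2) ->
  exists2 f : broadcast2 T,
    forall s, w s <= f (p s) & cost f <= \sum_s w s.
Proof.
move=> w_le2.
pose g t := \max_(s | p s == t) w s.
have g_le2 t : g t < 3 by rewrite ltnS; apply/bigmax_leqP => s _.
exists [ffun t => inord (g t)] => [s|].
  by rewrite ffunE inordK // /g (leq_bigmax_cond (P := fun s' => p s' == p s)).
rewrite /cost (partition_big p predT) //=.
apply: leq_sum => t _; rewrite ffunE inordK // /g.
apply/bigmax_leqP => s ps; rewrite (bigD1 s) //=; exact: leq_addr.
Qed.

(** * The perfect code and its projection onto the grid *)

(** The offset k ranges over the 13 translates of the code. *)
Definition code (k X Y : nat) : bool := 13 %| X + 5 * Y + k.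

(** The displacement is (i - 2, j - 2), written so as to stay in nat: cell (x, y)
    of the grid has code coordinates (x + 2, y + 2). *)
Lemma code_perfect k x y :
  exists i j, [/\ absdiff i 2 + absdiff j 2 <= 2 & code k (x + i) (y + j)].
Proof.
have /hasP[[i j] _ /andP[dij cij]] : has
    (fun ij => (absdiff ij.1 2 + absdiff ij.2 2 <= 2) &&
               (13 %| ij.1 + 5 * ij.2 + (x + 5 * y + k) %% 13))
    [seq (i, j) | i <- iota 0 5, j <- iota 0 5].
  have := ltn_pmod (x + 5 * y + k) (isT : 0 < 13).
  by move: (_ %% 13); do 13 case=> //.
exists i, j; split=> //; move: cij; rewrite /code /dvdn modnDmr /=.
by congr (_ %% _ == _); lia.
Qed.

(** Distance from the code coordinate X to the interval 2, ..., m + 1 of the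
    coordinates of grid cells. *)
Definition outside (m X : nat) : nat := (2 - X) + (X - m.+1).

(** Strength kept by a code point: 2 inside the grid, 1 at distance 1 or 2 from
    it, and 0 further away, where it serves no vertex of the grid. *)
Definition weight (m n X Y : nat) : nat :=
  (outside m X + outside n Y == 0) + (outside m X + outside n Y <= 2).

Definition clamp (m X : nat) : 'I_m.+1 := inord (minn (X - 2) m).

Lemma clampE m X : clamp m X = minn (X - 2) m :> nat.
Proof. by rewrite inordK // ltnS geq_minr. Qed.

(** Clamping a coordinate that lies outside brings it closer to every point of
    the interval by exactly the amount by which it was outside. *)
Lemma clamp_dist m x i : x < m.+1 ->
  absdiff x (minn (x + i - 2) m) + outside m.+1 (x + i) = absdiff i 2.
Proof. by rewrite /absdiff /outside; lia. Qed.

Lemma gamma_le_weight m n k :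
  gamma_b2 (@grid m.+1 n.+1) <=
    \sum_(X < m.+1 + 4) \sum_(Y < n.+1 + 4) code k X Y * weight m.+1 n.+1 X Y.
Proof.
pose S : finType := ('I_(m.+1 + 4) * 'I_(n.+1 + 4))%type.
have w_le2 (s : S) : code k s.1 s.2 * weight m.+1 n.+1 s.1 s.2 <= 2.
  by apply: (@leq_mul _ _ 1 2); rewrite ?leq_b1 // (@leq_add _ _ 1 1) ?leq_b1.
have [f le_f cost_f] :=
  pushforward_broadcast (fun s : S => (clamp m s.1, clamp n s.2)) w_le2.
rewrite pair_bigA; apply: leq_trans cost_f.
have [_ -> //] := gamma_b2P (@grid m.+1 n.+1).
apply/forallP => -[x y].
have [i [j [dij cij]]] := code_perfect k x y.
have hi : x + i < m.+1 + 4 by move: (ltn_ord x) dij; rewrite /absdiff; lia.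
have hj : y + j < n.+1 + 4 by move: (ltn_ord y) dij; rewrite /absdiff; lia.
have := le_f (Ordinal hi, Ordinal hj); rewrite /= cij mul1n => le_w.
apply/existsP; exists (clamp m (x + i), clamp n (y + j)).
suff [w_gt0 w_ge] : 0 < weight m.+1 n.+1 (x + i) (y + j) /\
    absdiff x (clamp m (x + i)) + absdiff y (clamp n (y + j)) <=
      weight m.+1 n.+1 (x + i) (y + j).
  by apply: grid_hears; [apply: leq_trans le_w | apply: leq_trans le_w].
move: dij; rewrite -(clamp_dist i (ltn_ord x)) -(clamp_dist j (ltn_ord y)) !clampE.
rewrite addnACA /weight.
(* o is the distance of the code point from the grid and d its distance from
   (x, y) once clamped; o + d <= 2, and the strength is 2 if o = 0, else 1. *)
move: (outside _ _ + _) (absdiff _ _ + _) => [|o] d; first by rewrite addn0.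
by move=> le2; rewrite (leq_trans (leq_addl _ _) le2) add0n; split=> //; lia.
Qed.

(** * Counting code points *)

Definition rect_count (k p A q B : nat) : nat :=
  \sum_(p <= X < p + A) \sum_(q <= Y < q + B) code k X Y.

Lemma rect_countE k p A q B :
  rect_count k p A q B =
  sumn [seq count (code k X) (iota q B) | X <- iota p A].
Proof.
rewrite /rect_count sumnE big_map /index_iota addKn.
apply: eq_bigr => X _; rewrite addKn -sum1_count [RHS]big_mkcond.
by apply: eq_bigr => Y _; case: code.
Qed.

(** X + 5 Y takes every residue modulo 13 once as X runs through 13 consecutive
    values; so it does in Y, since 5 is invertible modulo 13. *)
Lemma code_row k p Y : \sum_(p <= X < p + 13) code k X Y = 1.
Proof.
rewrite -{1}[p]add0n big_addn addKn big_mkord.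
rewrite (eq_bigr (fun i : 'I_13 => (13 %| i + (p + 5 * Y + k) %% 13) : nat)).
  have := ltn_pmod (p + 5 * Y + k) (isT : 0 < 13).
  by move: (_ %% 13); do 13?[case]=> //; rewrite !big_ord_recl big_ord0.
by move=> i _; rewrite /code /dvdn modnDmr; congr (nat_of_bool (_ %% _ == _)); lia.
Qed.

Lemma code_col k X q : \sum_(q <= Y < q + 13) code k X Y = 1.
Proof.
rewrite -{1}[q]add0n big_addn addKn big_mkord.
rewrite (eq_bigr (fun i : 'I_13 => (13 %| 5 * i + (X + 5 * q + k) %% 13) : nat)).
  have := ltn_pmod (X + 5 * q + k) (isT : 0 < 13).
  by move: (_ %% 13); do 13?[case]=> //; rewrite !big_ord_recl big_ord0.
by move=> i _; rewrite /code /dvdn modnDmr; congr (nat_of_bool (_ %% _ == _)); lia.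
Qed.

Lemma rect_count_addl k p A q B :
  rect_count k p (A + 13) q B = rect_count k p A q B + B.
Proof.
rewrite /rect_count (big_cat_nat (n := p + A)) ?leq_addr //=; last by lia.
congr addn; rewrite exchange_big /= addnA.
under eq_bigr do rewrite code_row.
by rewrite sum_nat_const_nat muln1 addKn.
Qed.

Lemma rect_count_addr k p A q B :
  rect_count k p A q (B + 13) = rect_count k p A q B + A.
Proof.
rewrite /rect_count addnA.
under eq_bigr do rewrite (big_cat_nat (n := q + B)) ?leq_addr //= code_col.
by rewrite big_split /= sum_nat_const_nat muln1 addKn.
Qed.

(** In grid coordinates, the cells (-1, -1), (m, -1), (-1, n), (m, n): the only ones that are outside
    in both coordinates and within distance 2 of the grid. *)
Definition corner_count (k m n : nat) : nat :=
  code k 1 1 + code k (m + 2) 1 + code k 1 (n + 2) + code k (m + 2) (n + 2).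

Definition total (k m n : nat) : nat :=
  rect_count k 2 m 0 (n + 4) + rect_count k 0 (m + 4) 2 n + corner_count k m n.

Lemma total_addl k m n : total k (m + 13) n = total k m n + (2 * n + 4).
Proof.
rewrite /total (addnAC m) !rect_count_addl.
suff -> : corner_count k (m + 13) n = corner_count k m n by lia.
have code13 X Y : code k (X + 13) Y = code k X Y.
  by rewrite /code -!addnA addnCA dvdn_addr.
by rewrite /corner_count (addnAC m) !code13.
Qed.

Lemma total_addr k m n : total k m (n + 13) = total k m n + (2 * m + 4).
Proof.
rewrite /total (addnAC n) !rect_count_addr.
suff -> : corner_count k m (n + 13) = corner_count k m n by lia.
have code13 X Y : code k X (Y + 13) = code k X Y.
  by rewrite /code mulnDr addnA addnAC dvdn_addl.
by rewrite /corner_count (addnAC n) !code13.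
Qed.

(** The quantity 13 total - (2 m n + 4 (m + n)) depends only on m and n modulo
    13; the equation is arranged to avoid subtraction. *)
Lemma total_shift k a b r s :
  13 * total k (13 * a + r) (13 * b + s) + (2 * r * s + 4 * (r + s)) =
  13 * total k r s +
    (2 * (13 * a + r) * (13 * b + s) + 4 * ((13 * a + r) + (13 * b + s))).
Proof.
elim: a => [|a IHa].
  rewrite muln0 add0n; elim: b => [|b IHb]; first by rewrite muln0 add0n.
  have -> : 13 * b.+1 + s = 13 * b + s + 13 by lia.
  rewrite total_addr; lia.
have -> : 13 * a.+1 + r = 13 * a + r + 13 by lia.
rewrite total_addl; lia.
Qed.

Lemma sum_border m (F : nat -> nat) :
  \sum_(X < m + 4) F X =
  \sum_(2 <= X < 2 + m) F X + (F 0 + F 1 + F (m + 2) + F (m + 3)).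
Proof.
rewrite -[X in index_iota X]add0n big_addn addKn big_mkord.
rewrite !addnS addn0 2!big_ord_recr 2!big_ord_recl /=.
rewrite (eq_bigr (fun i : 'I_m => F (i + 2))) => [|i _]; last by rewrite addn2.
by rewrite -[bump 0 0]/1; move: (\sum_(i < m) _); lia.
Qed.

Lemma outside_border m :
  [/\ outside m 0 = 2, outside m 1 = 1, outside m (m + 2) = 1
    & outside m (m + 3) = 2].
Proof. by rewrite /outside; split; lia. Qed.

Lemma outside_inner m X : 2 <= X < 2 + m -> outside m X = 0.
Proof. by rewrite /outside; lia. Qed.

Lemma sum_inner m (F : nat -> nat) :
  \sum_(X < m + 4) (outside m X == 0) * F X = \sum_(2 <= X < 2 + m) F X.
Proof.
rewrite (sum_border m (fun X => (outside m X == 0) * F X)).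
have [-> -> -> ->] := outside_border m; rewrite addn0.
by apply: eq_big_nat => X /outside_inner ->; rewrite mul1n.
Qed.

Lemma sum_edge m (F : nat -> nat) :
  \sum_(X < m + 4) (outside m X == 1) * F X = F 1 + F (m + 2).
Proof.
rewrite (sum_border m (fun X => (outside m X == 1) * F X)).
have [-> -> -> ->] := outside_border m; rewrite !mul0n !mul1n addn0 !add0n.
by rewrite big_nat big1 // => X /outside_inner ->.
Qed.

(** The weight is at most [X in rows] + [Y in columns] + [corner]: both first
    indicators hold inside the grid, at least one holds on the side strips, and
    only the last one remains at a corner. *)
Lemma sum_weight_le k m n :
  \sum_(X < m + 4) \sum_(Y < n + 4) code k X Y * weight m n X Y <= total k m n.
Proof.
pose in_rows := \sum_(X < m + 4) (outside m X == 0) * \sum_(Y < n + 4) code k X Y.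
pose in_cols := \sum_(X < m + 4) \sum_(Y < n + 4) (outside n Y == 0) * code k X Y.
pose corners := \sum_(X < m + 4) (outside m X == 1) *
                   \sum_(Y < n + 4) (outside n Y == 1) * code k X Y.
have -> : total k m n = in_rows + in_cols + corners.
  congr (_ + _ + _); rewrite /in_rows /in_cols /corners.
  - rewrite (sum_inner m (fun X => \sum_(Y < n + 4) code k X Y)).
    by apply: eq_bigr => X _; rewrite add0n big_mkord.
  - rewrite /rect_count add0n big_mkord.
    by apply: eq_bigr => X _; rewrite (sum_inner n (fun Y => code k X Y)).
  under eq_bigr => X _ do rewrite (sum_edge n (fun Y => code k X Y)).
  by rewrite (sum_edge m (fun X => code k X 1 + code k X (n + 2))) /corner_count; lia.
rewrite -!big_split /=; apply: leq_sum => X _.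
rewrite !big_distrr -!big_split /=; apply: leq_sum => Y _.
rewrite /weight; case: code => //.
by case: (outside m X) (outside n Y) => [|[|a]] [|[|b]] //; lia.
Qed.

(** * The finite check over residues *)

(** Iterated sums are opaque to evaluation; this form of [total] computes. *)
Definition total_eval (k m n : nat) : nat :=
  sumn [seq count (code k X) (iota 0 (n + 4)) | X <- iota 2 m]
  + sumn [seq count (code k X) (iota 2 n) | X <- iota 0 (m + 4)]
  + corner_count k m n.

Definition good_offset (r s k : nat) : bool :=
  ((13 * total_eval k r s)%:Z <= (2 * r * s + 4 * (r + s))%:Z + c r s)%R.

Lemma good_offset_ex :
  all (fun r => all (fun s => has (good_offset r s) (iota 0 13)) (iota 0 13))
    (iota 0 13).
Proof. by vm_compute. Qed.

Lemma total_small r s : r < 13 -> s < 13 ->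
  exists k, ((13 * total k r s)%:Z <= (2 * r * s + 4 * (r + s))%:Z + c r s)%R.
Proof.
move=> hr hs.
have /allP/(_ r) := good_offset_ex.
rewrite mem_iota => /(_ hr)/allP/(_ s).
rewrite mem_iota => /(_ hs)/hasP[k _].
by rewrite /good_offset => le_k; exists k; rewrite /total !rect_countE.
Qed.

Local Open Scope ring_scope.

Theorem theorem2 (m n : nat) (hm : (13 <= m)%N) (hn : (13 <= n)%N) :
  (gamma_b2 (@grid m n))%:R <=
    2 * ((m%:R * n%:R) / 13) + 4 * ((m%:R + n%:R) / 13)
      + (c (m %% 13)%N (n %% 13)%N)%:~R / 13 :> rat.
Proof.
have [k le_k] := total_small (ltn_pmod m (isT : 0 < 13)%N) (ltn_pmod n (isT : 0 < 13)%N).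
have gamma_le : (gamma_b2 (@grid m n) <= total k m n)%N.
  case: m n hm hn {le_k} => // m [] // n _ _.
  exact: leq_trans (gamma_le_weight _ _ k) (sum_weight_le _ _ _).
have := total_shift k (m %/ 13)%N (n %/ 13)%N (m %% 13)%N (n %% 13)%N.
rewrite !(mulnC 13 (_ %/ 13)%N) -!divn_eq => tot_mod.
have : (13 * gamma_b2 (@grid m n))%:Z <=
    (2 * m * n + 4 * (m + n))%:Z + c (m %% 13) (n %% 13).
  move: le_k tot_mod gamma_le; move: (c _ _) => cc; lia.
rewrite -(ler_int rat) intrD -!pmulrn (natrM _ 13) natrD !natrM natrD.
move: (_%:~R) (gamma_b2 _)%:R => cc g; lra.
Qed.
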